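(* The following two identities hold (as formal power series in $a$ and $q$): $$\sum_{m,k\geq 0}\frac{(-a)^m q^{(m-k)^2+k^2+m-k}}{(aq^2;q^2)_m}\begin{bmatrix} m\\ 2k-1\end{bmatrix}_q=\sum_{n\geq 1}(-a)^n q^{n^2},$$ $$\sum_{m,k\geq 0}\frac{(-a)^m q^{(m-k)^2+k^2+k}}{(aq^2;q^2)_m}\begin{bmatrix} m\\ 2k\end{bmatrix}_q=\sum_{n\geq 0}(-a)^n q^{n^2}.$$
   Context: Here $a$ and $q$ are indeterminates, $(x;p)_m=\prod_{i=0}^{m-1}(1-xp^i)$ with $(x;p)_0=1$, so $(aq^2;q^2)_m=\prod_{i=1}^m(1-aq^{2i})$. For integers $m\ge 0$ and $j$, the Gaussian binomial coefficient is $\begin{bmatrix} m\\ j\end{bmatrix}_q=\frac{(q;q)_m}{(q;q)_j(q;q)_{m-j}}$ if $0\le j\le m$, and $0$ otherwise (in particular it is $0$ for $j=-1$). *)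

(* Defs.v *)
From HB Require Import structures.
From mathcomp Require Import all_boot all_order all_algebra.
From mathcomp Require Import boolp classical_sets cardinality fsbigop.

Set Implicit Arguments.
Unset Strict Implicit.
Unset Printing Implicit Defensive.

Import GRing.Theory.
Local Open Scope ring_scope.

(* A record rather than a bare [nat -> R], which already carries the pointwise *)
(* ring structure in mathcomp-classical.                                       *)
Record fps (R : Type) := Fps { fps_coef : nat -> R }.

Notation "{ 'fps' R }" := (fps R) (at level 0, R at level 2, format "{ 'fps'  R }").

Lemma fpsP (R : Type) (f g : {fps R}) : fps_coef f =1 fps_coef g -> f = g.
Proof. by case: f g => [f] [g] /= /funext ->. Qed.

HB.instance Definition _ (R : Type) := gen_eqMixin {fps R}.
HB.instance Definition _ (R : Type) := gen_choiceMixin {fps R}.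

Section FpsRing.
Variable R : comNzRingType.
Implicit Types f g h : {fps R}.

Definition fps_zero : {fps R} := Fps (fun=> 0).
Definition fps_opp f : {fps R} := Fps (fun n => - fps_coef f n).
Definition fps_add f g : {fps R} := Fps (fun n => fps_coef f n + fps_coef g n).
Definition fps_const (c : R) : {fps R} := Fps (fun n => if n is 0 then c else 0).
Definition fps_mul f g : {fps R} :=
  Fps (fun n => \sum_(i < n.+1) fps_coef f i * fps_coef g (n - i)%N).

Fact fps_addA : associative fps_add.
Proof. by move=> f g h; apply: fpsP => n /=; rewrite addrA. Qed.
Fact fps_addC : commutative fps_add.
Proof. by move=> f g; apply: fpsP => n /=; rewrite addrC. Qed.
Fact fps_add0 : left_id fps_zero fps_add.
Proof. by move=> f; apply: fpsP => n /=; rewrite add0r. Qed.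
Fact fps_addN : left_inverse fps_zero fps_opp fps_add.
Proof. by move=> f; apply: fpsP => n /=; rewrite addNr. Qed.

HB.instance Definition _ :=
  GRing.isZmodule.Build {fps R} fps_addA fps_addC fps_add0 fps_addN.

Definition fps_trunc N f : {poly R} := \poly_(i < N) fps_coef f i.

Fact fps_mul_trunc N f g n : (n < N)%N ->
  fps_coef (fps_mul f g) n = (fps_trunc N f * fps_trunc N g)`_n.
Proof.
move=> nN; rewrite coefM /=; apply: eq_bigr => i _; rewrite !coef_poly.
by rewrite (leq_ltn_trans _ nN) ?(leq_ltn_trans (leq_subr _ _) nN) // -ltnS.
Qed.

Fact fps_mulC : commutative fps_mul.
Proof.
by move=> f g; apply: fpsP => n; rewrite !(fps_mul_trunc _ _ (ltnSn n)) mulrC.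
Qed.

Fact fps_mulA : associative fps_mul.
Proof.
move=> f g h; apply: fpsP => n; have nn := ltnSn n; pose t := fps_trunc n.+1.
have tM u v i : (i < n.+1)%N -> (t (fps_mul u v))`_i = (t u * t v)`_i.
  by move=> iN; rewrite coef_poly iN (fps_mul_trunc _ _ iN).
rewrite !(fps_mul_trunc _ _ nn) -/t.
transitivity (t f * (t g * t h))`_n.
  rewrite !coefM; apply: eq_bigr => i _.
  by rewrite tM // ltnS leq_subr.
by rewrite mulrA !coefM; apply: eq_bigr => i _; rewrite tM.
Qed.

Fact fps_mul1 : left_id (fps_const 1) fps_mul.
Proof.
move=> f; apply: fpsP => n /=; rewrite big_ord_recl /= mul1r subn0.
by rewrite big1 ?addr0 // => i _; rewrite mul0r.
Qed.

Fact fps_mulDl : left_distributive fps_mul fps_add.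
Proof.
move=> f g h; apply: fpsP => n /=; rewrite -big_split /=.
by apply: eq_bigr => i _; rewrite mulrDl.
Qed.

Fact fps_oner_neq0 : fps_const 1 != 0.
Proof.
by apply/eqP => /(congr1 (fun f => fps_coef f 0)) /eqP; rewrite oner_eq0.
Qed.

HB.instance Definition _ := GRing.Zmodule_isComNzRing.Build {fps R}
  fps_mulA fps_mulC fps_mul1 fps_mulDl fps_oner_neq0.

Definition fps_var : {fps R} := Fps (fun n => if n == 1%N then 1 else 0).

End FpsRing.

Section FpsUnit.
Variable R : comUnitRingType.
Implicit Types f g : {fps R}.

Definition fps_unit : {pred {fps R}} :=
  [pred f | fps_coef f 0 \is a GRing.unit].

(* The first n.+1 coefficients of the inverse, obtained by solving            *)
(* \sum_(i < n.+1) g_i f_(n - i) = (n == 0) for g_n, for n = 0, 1, ...        *)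
Definition fps_inv_seq f (n : nat) : seq R :=
  iter n (fun s => rcons s
      (- (fps_coef f 0)^-1 * \sum_(i < size s) s`_i * fps_coef f (size s - i)%N))
    [:: (fps_coef f 0)^-1].

Definition fps_inv f : {fps R} :=
  if f \in fps_unit then Fps (fun n => (fps_inv_seq f n)`_n) else f.

Fact size_fps_inv_seq f n : size (fps_inv_seq f n) = n.+1.
Proof. by elim: n => //= n IHn; rewrite size_rcons IHn. Qed.

Fact nth_fps_inv_seq f n i : (i <= n)%N ->
  (fps_inv_seq f n)`_i = (fps_inv_seq f i)`_i.
Proof.
elim: n => [|n IHn]; first by case: i.
rewrite leq_eqVlt => /predU1P[-> //|]; rewrite ltnS => lin.
by rewrite [LHS]nth_rcons size_fps_inv_seq ltnS lin IHn.
Qed.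

Fact fps_mulVf : {in fps_unit, left_inverse 1 fps_inv *%R}.
Proof.
move=> f Uf; apply: fpsP => n; rewrite /fps_inv Uf /=.
have Uf0 : fps_coef f 0 \is a GRing.unit by [].
case: n => [|n]; first by rewrite big_ord1 subnn /= mulVr.
rewrite big_ord_recr subnn /= nth_rcons size_fps_inv_seq ltnn eqxx.
rewrite mulrAC mulNr mulVr // mulN1r.
rewrite (eq_bigr (fun i : 'I_n.+1 =>
    (fps_inv_seq f n)`_i * fps_coef f (n.+1 - i))) ?subrr //.
by move=> i _; rewrite (nth_fps_inv_seq f (n := n)) // -ltnS.
Qed.

Fact fps_unitPl f g : g * f = 1 -> fps_unit f.
Proof.
move=> /(congr1 (fun h => fps_coef h 0)) /=; rewrite big_ord1 subnn => gf.
by apply/unitrPr; exists (fps_coef g 0); rewrite mulrC.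
Qed.

Fact fps_inv_out : {in [predC fps_unit], fps_inv =1 id}.
Proof. by move=> f; rewrite inE /fps_inv => /negbTE ->. Qed.

HB.instance Definition _ := GRing.ComNzRing_hasMulInverse.Build {fps R}
  fps_mulVf fps_unitPl fps_inv_out.

End FpsUnit.

(* R[[a, q]] is represented as R[[q]][[a]]. *)
Definition varA (R : comUnitRingType) : {fps {fps R}} := fps_var {fps R}.
Definition varQ (R : comUnitRingType) : {fps {fps R}} := fps_const (fps_var R).

(* The coefficient of a^i q^j. *)
Definition coef2 (R : Type) (f : {fps {fps R}}) (i j : nat) : R :=
  fps_coef (fps_coef f i) j.

Definition fps_summable (R : comUnitRingType) (I : choiceType) (D : set I)
    (F : I -> {fps {fps R}}) : Prop :=
  forall i j, finite_set [set x | D x /\ coef2 (F x) i j <> 0]%classic.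

(* Meaningful only for summable families: a coefficient with infinitely many  *)
(* nonzero contributions is set to 0.                                         *)
Definition fps_sum (R : comUnitRingType) (I : choiceType) (D : set I)
    (F : I -> {fps {fps R}}) : {fps {fps R}} :=
  Fps (fun i => Fps (fun j => \sum_(x \in D) coef2 (F x) i j)).

Definition qpoch (A : comUnitRingType) (x p : A) (m : nat) : A :=
  \prod_(i < m) (1 - x * p ^+ i).

Definition qbinom (A : comUnitRingType) (q : A) (m : nat) (j : int) : A :=
  if (0 <= j <= m%:Z) then
    qpoch q q m / (qpoch q q `|j| * qpoch q q (m - `|j|))
  else 0.

(* Both integers are nonnegative for all m, k >= 0, as x ^ 2 + x >= 0 for     *)
(* every integer x; the subtraction m - k is in int, hence not truncated.     *)
Definition exponent1 (m k : nat) : nat :=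
  absz ((m%:Z - k%:Z) ^+ 2 + k%:Z ^+ 2 + m%:Z - k%:Z)%R.
Definition exponent2 (m k : nat) : nat :=
  absz ((m%:Z - k%:Z) ^+ 2 + k%:Z ^+ 2 + k%:Z)%R.

(* Main.v *)
Require Import Defs.
From mathcomp Require Import all_boot all_order all_algebra.
From mathcomp Require Import boolp classical_sets cardinality fsbigop.
From mathcomp Require Import ring zify.
Import GRing.Theory.
Local Open Scope ring_scope.

(** Both exponents are the same function of [j], the lower entry of the
    Gaussian binomial ([j = 2k - 1], resp. [j = 2k]):
    [m (m - j) + j (j + 1) / 2].  So the two sums over [k] are the odd and the
    even part of the expansion of
      [q^(m^2) (1 + x) (1 + x q^-1) ... (1 + x q^-(m-1))]
    in powers of [x], at [x = 1].  For [m >= 1] the factor [1 + x] makes the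
    odd and even parts equal, both to what remains of the product,
      [q^(m(m+1)/2) (1 + q) ... (1 + q^(m-1))]
    (lemmas [sum_row_odd] and [sum_row_even]; working with the factor removed
    avoids a division by 2).  The row [m = 0] contributes only to the even sum,
    which accounts for the term [n = 0] on the right of the second identity.

    Both identities thus reduce to [G(a) = T(a)], where
      [G(x) = sum_(m >= 1)
          (-x)^m q^(m(m+1)/2) (1 + q) ... (1 + q^(m-1)) / (x q^2; q^2)_m]
    and [T(x) = sum_(n >= 1) (-x)^n q^(n^2)].  Obviously
    [T(x) = - x q (1 + T(x q^2))], and [G] satisfies the same equation because
    the difference of its two sides telescopes.  The telescoping is done on
    partial sums ([reduced_sum_shift]), where it leaves one term divisible by a
    high power of [x]; iterating gives [G = T] modulo [x^(N+1)] for the [N]-th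
    partial sums ([reduced_sum_theta]), in any commutative ring where the
    denominators are units.

    In the ring of power series in [a] and [q], the coefficient of [a^i] of
    each infinite sum only sees the finitely many terms with [m <= i], so the
    congruence modulo [a^(i+1)] is all that is needed ([fps_sum_finite]). *)

(** * Gaussian binomial coefficients *)

(** Defining the coefficients by the Pascal rule makes them available in every
    commutative ring, whether or not the [1 - q^i] are invertible. *)
Fixpoint gauss (A : comNzRingType) (q : A) (m j : nat) : A :=
  match m, j with
  | _, 0%N => 1
  | 0%N, _.+1 => 0
  | m'.+1, j'.+1 => gauss A q m' j'.+1 + q ^+ (m' - j') * gauss A q m' j'
  end.
Arguments gauss {A} q m j.

Lemma gauss0 {A : comNzRingType} (q : A) m : gauss q m 0 = 1.
Proof. by case: m. Qed.

Lemma gauss_small {A : comNzRingType} (q : A) {m j} : (m < j)%N -> gauss q m j = 0.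
Proof.
elim: m j => [|m IHm] [|j] //= lt_mj; rewrite !IHm ?mulr0 ?addr0 //.
exact: ltnW.
Qed.

Lemma gauss_nn {A : comNzRingType} (q : A) m : gauss q m m = 1.
Proof. by elim: m => //= m IHm; rewrite gauss_small // subnn mul1r add0r. Qed.

Lemma qpochS {A : comUnitRingType} (x p : A) m :
  qpoch x p m.+1 = qpoch x p m * (1 - x * p ^+ m).
Proof. by rewrite /qpoch big_ord_recr. Qed.

Lemma qpoch_recl {A : comUnitRingType} (x p : A) m :
  qpoch x p m.+1 = (1 - x) * qpoch (x * p) p m.
Proof.
rewrite /qpoch big_ord_recl mulr1; congr (_ * _).
by apply: eq_bigr => i _; rewrite exprS mulrA.
Qed.

Lemma gauss_qpoch {A : comUnitRingType} (q : A) {m j} : (j <= m)%N ->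
  gauss q m j * (qpoch q q j * qpoch q q (m - j)) = qpoch q q m.
Proof.
elim: m j => [|m IHm] [|j] //= le_jm;
  rewrite ?mul1r ?subn0 ?[qpoch q q 0]big_ord0 ?mul1r //.
rewrite subSS; have [eq_jm|lt_jm] := eqVneq j m.
  rewrite eq_jm gauss_small // subnn gauss_nn [qpoch q q 0]big_ord0.
  by rewrite !mulr1 add0r mul1r.
have {}lt_jm : (j < m)%N by rewrite ltn_neqAle lt_jm.
have IH1 := IHm _ lt_jm; have IH2 := IHm _ (ltnW lt_jm).
(* Each half of the Pascal rule lacks one factor of the denominator; the sum
   of the two missing factors, suitably weighted, is [1 - q^(m+1)]. *)
have Em : qpoch q q (m - j) = qpoch q q (m - j.+1) * (1 - q ^+ (m - j)).
  by rewrite -[(m - j)%N](subnSK lt_jm) qpochS -exprS.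
have Eq : q ^+ m = q ^+ (m - j) * q ^+ j by rewrite -exprD subnK // ltnW.
transitivity (
  gauss q m j.+1 * (qpoch q q j.+1 * qpoch q q (m - j.+1)) * (1 - q ^+ (m - j))
  + q ^+ (m - j) * (1 - q * q ^+ j)
    * (gauss q m j * (qpoch q q j * qpoch q q (m - j)))).
  rewrite Em (qpochS _ _ j); ring.
rewrite IH1 IH2 qpochS Eq; ring.
Qed.

Lemma qbinom_gauss {A : comUnitRingType} (q : A) (m j : nat) :
  (forall n, qpoch q q n \is a GRing.unit) -> qbinom q m j%:Z = gauss q m j.
Proof.
move=> qU; rewrite /qbinom /= lez_nat.
have [le_jm|lt_mj] := leqP j m; last by rewrite gauss_small.
by rewrite -(gauss_qpoch q le_jm) mulrK // unitrM !qU.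
Qed.

(** The homogeneous form allows [y] to be a power of [q], which replaces the
    negative powers of [q] of the informal argument. *)
Lemma qbinomial_theorem {A : comNzRingType} (q x y : A) m :
  \prod_(i < m) (y + x * q ^+ i) =
  \sum_(j < m.+1) gauss q m j * q ^+ 'C(j, 2) * x ^+ j * y ^+ (m - j).
Proof.
elim: m => [|m IHm]; first by rewrite big_ord0 big_ord1 /= !mulr1.
rewrite big_ord_recr /= IHm mulrDr.
rewrite big_ord_recl [in RHS]big_ord_recl /= gauss0.
rewrite [X in _ = _ + X](eq_bigr (fun j : 'I_m.+1 =>
  gauss q m j.+1 * q ^+ 'C(j.+1, 2) * x ^+ j.+1 * y ^+ (m - j) +
  gauss q m j * q ^+ 'C(j, 2) * x ^+ j * y ^+ (m - j) * (x * q ^+ m))); last first.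
  move=> j _; rewrite /bump /= add1n subSS.
  have -> : q ^+ m = q ^+ (m - j) * q ^+ j by rewrite -exprD subnK // -ltnS.
  rewrite binS bin1 exprD [x ^+ j.+1]exprS; ring.
rewrite big_split /= -mulr_suml [X in _ = _ + (X + _)]big_ord_recr /=.
rewrite gauss_small // !mul0r addr0 addrA.
congr (_ + _); last by rewrite [in RHS]big_ord_recl gauss0.
rewrite mulrDl !subn0 exprSr mulrA; congr (_ + _).
rewrite mulr_suml; apply: eq_bigr => j _; rewrite /bump /= add1n.
by rewrite -(subnSK (ltn_ord j)) [y ^+ (m - j.+1).+1]exprSr !mulrA.
Qed.

(** * The even and odd parts of a row *)

(** The coefficient of [x^j] in [q^(m^2) (1 + x) ... (1 + x q^-(m-1))]. *)
Definition row_term {A : comNzRingType} (q : A) (m j : nat) : A :=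
  q ^+ (m * (m - j) + 'C(j.+1, 2)) * gauss q m j.

(** The coefficient of [x^j] in the same product for [m + 1], with the factor
    [1 + x] left out. *)
Definition half_row_term {A : comNzRingType} (q : A) (m j : nat) : A :=
  q ^+ (m.+1 * (m.+1 - j) + 'C(j.+1, 2)) * gauss q m j.

Lemma row_term0 {A : comNzRingType} (q : A) m :
  row_term q m.+1 0 = half_row_term q m 0.
Proof. by rewrite /row_term /half_row_term !gauss0. Qed.

(** Multiplication by [1 + x], read on coefficients; this is the Pascal rule. *)
Lemma row_termS {A : comNzRingType} (q : A) m j :
  row_term q m.+1 j.+1 = half_row_term q m j.+1 + half_row_term q m j.
Proof.
rewrite /row_term /half_row_term /= mulrDr mulrA -exprD; congr (_ + _).
have [lt_mj|le_jm] := ltnP m j; first by rewrite gauss_small // !mulr0.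
congr (_ ^+ _ * _); rewrite (binS j.+1) bin1; nia.
Qed.

(** The product without [1 + x], evaluated at [x = 1]. *)
Lemma sum_half_row {A : comNzRingType} (q : A) {m N : nat} : (m < N)%N ->
  \sum_(j < N) half_row_term q m j =
  q ^+ 'C(m.+2, 2) * \prod_(i < m) (1 + q ^+ i.+1).
Proof.
move=> lt_mN; rewrite -(subnKC lt_mN) big_split_ord /=.
rewrite [X in _ + X]big1 ?addr0; last first.
  by move=> j _; rewrite /half_row_term gauss_small ?mulr0 // addSn ltnS leq_addr.
transitivity (q ^+ m.+1 * \prod_(i < m) (q ^+ m.+1 + q * q ^+ i)).
  rewrite qbinomial_theorem mulr_sumr; apply: eq_bigr => j _.
  rewrite /half_row_term -exprM subSn -1?ltnS // mulnS binS bin1 !exprD; ring.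
(* Pulling [q^(i+1)] out of the [i]-th factor leaves [1 + q^(m-i)]. *)
rewrite binS bin1 exprD [q ^+ 'C(_, 2) * _]mulrC -mulrA; congr (_ * _).
rewrite (reindex_inj rev_ord_inj) /=.
have -> : q ^+ 'C(m.+1, 2) = \prod_(i < m) q ^+ (m - i).
  rewrite (reindex_inj rev_ord_inj) /=.
  rewrite (eq_bigr (fun i : 'I_m => q ^+ i.+1)); last by move=> i _; rewrite subKn.
  elim: m {lt_mN} => [|m IHm]; first by rewrite big_ord0.
  by rewrite big_ord_recr /= -IHm -exprD binS bin1 addnC.
rewrite -big_split; apply: eq_bigr => i _ /=.
rewrite -exprS -(subSn (ltn_ord i)) subSS mulrDr mulr1 -exprD addrC.
by congr (_ + q ^+ _); have := ltn_ord i; lia.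
Qed.

(** Each coefficient of a product with [1 + x] is the sum of two consecutive
    coefficients of the other factor, so that every coefficient of that factor
    occurs once in the even part, and once in the odd part. *)
Lemma sum_row_even {A : comNzRingType} (q : A) {m N : nat} : (m < N)%N ->
  \sum_(k < N.+1) row_term q m.+1 (2 * k) =
  q ^+ 'C(m.+2, 2) * \prod_(i < m) (1 + q ^+ i.+1).
Proof.
move=> lt_mN; rewrite -(sum_half_row q (N := (2 * N).+1)); last by lia.
elim: N {lt_mN} => [|N IHN]; first by rewrite !big_ord1 row_term0.
rewrite big_ord_recr /= IHN mulnS !addSn add0n row_termS !big_ord_recr /=.
by rewrite [X in _ + X]addrC !addrA.
Qed.

Lemma sum_row_odd {A : comNzRingType} (q : A) {m N : nat} : (m < N)%N ->
  \sum_(k < N) row_term q m.+1 (2 * k).+1 =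
  q ^+ 'C(m.+2, 2) * \prod_(i < m) (1 + q ^+ i.+1).
Proof.
move=> lt_mN; rewrite -(sum_half_row q (N := 2 * N)%N); last by lia.
elim: N {lt_mN} => [|N IHN]; first by rewrite muln0 !big_ord0.
rewrite big_ord_recr /= IHN mulnS !addSn add0n row_termS !big_ord_recr /=.
by rewrite [X in _ + X]addrC addrA.
Qed.

(** * The reduced series and its functional equation *)

(** The [m.+1]-st row of either double sum, once the sum over [k] has been
    carried out. *)
Definition reduced_term {A : comUnitRingType} (x q : A) (m : nat) : A :=
  (- x) ^+ m.+1 * q ^+ 'C(m.+2, 2) * \prod_(i < m) (1 + q ^+ i.+1)
    / qpoch (x * q ^+ 2) (q ^+ 2) m.+1.

(** What the telescoping leaves over after [m.+1] terms. *)
Definition reduced_rest {A : comUnitRingType} (x q : A) (m : nat) : A :=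
  (- x) ^+ m.+2 * q ^+ 'C(m.+3, 2) * \prod_(i < m) (1 + q ^+ i.+1)
    / qpoch (x * q ^+ 2) (q ^+ 2) m.+1.

(** Writing [u_m] for [reduced_rest x q m], the lemma comes from
      [reduced_term x q (m+1) + x q reduced_term (x q^2) q m = u_m - u_(m+1)].
    Over the common denominator [(x q^2; q^2)_(m+2)], and up to the common
    factor [(-x)^(m+2) q^((m+2)(m+3)/2) (1 + q) ... (1 + q^m)], both sides are
    [1 + x q^(m+3)]. *)
Lemma reduced_sum_shift {A : comUnitRingType} (x q : A) N :
  (forall i, 1 - x * q ^+ i.+1 \is a GRing.unit) ->
  \sum_(m < N.+1) reduced_term x q m =
  - x * q * (1 + \sum_(m < N) reduced_term (x * q ^+ 2) q m) - reduced_rest x q N.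
Proof.
move=> xU.
have pU m : qpoch (x * q ^+ 2) (q ^+ 2) m \is a GRing.unit.
  rewrite /qpoch; apply: rpred_prod => i _.
  by rewrite -mulrA -exprM -exprD; apply: xU.
elim: N => [|N IHN].
  rewrite big_ord1 big_ord0 /reduced_term /reduced_rest !big_ord0 !binS !bin0n /=.
  rewrite /qpoch big_ord1 expr0 mulr1; set d := 1 - _.
  have dU : d \is a GRing.unit by apply: xU.
  rewrite -[X in _ = X - _](mulrK dU) -mulrBl; congr (_ / _).
  rewrite /d; ring.
rewrite big_ord_recr /= IHN [in RHS]big_ord_recr /=.
suff -> : reduced_term x q N.+1 = - x * q * reduced_term (x * q ^+ 2) q N
     + reduced_rest x q N - reduced_rest x q N.+1 by ring.
rewrite /reduced_term /reduced_rest.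
have pN2 := pU N.+2.
have -> : (qpoch (x * q ^+ 2 * q ^+ 2) (q ^+ 2) N.+1)^-1 =
          (1 - x * q ^+ 2) / qpoch (x * q ^+ 2) (q ^+ 2) N.+2.
  move: pN2; rewrite qpoch_recl unitrM => /andP[dU eU].
  by rewrite (invrM dU eU) [RHS]mulrCA (mulrV dU) mulr1.
set e := 1 - x * q ^+ 2 * (q ^+ 2) ^+ N.+1.
have -> : (qpoch (x * q ^+ 2) (q ^+ 2) N.+1)^-1 =
          e / qpoch (x * q ^+ 2) (q ^+ 2) N.+2.
  move: pN2; rewrite (qpochS _ _ N.+1) unitrM => /andP[dU eU].
  by rewrite (invrM dU eU) [RHS]mulrA (mulrV eU) mul1r.
move: (_^-1) => D; rewrite big_ord_recr /= /e.
have {e}-> : (q ^+ 2) ^+ N.+1 = q ^+ N.+1 * q ^+ N.+1.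
  by rewrite -exprD addnn -mul2n exprM.
have C3 : 'C(N.+3, 2) = ('C(N.+2, 2) + N.+2)%N by rewrite binS bin1.
have C4 : 'C(N.+4, 2) = ('C(N.+3, 2) + N.+3)%N by rewrite binS bin1.
rewrite C4 C3; move: 'C(_, _) (\prod_(i < N) _) => c P.
have -> : (- (x * q ^+ 2)) ^+ N.+1 = (- x) ^+ N.+1 * (q ^+ N.+1 * q ^+ N.+1).
  by rewrite -mulNr exprMn -exprM mulnC -exprD addnn -muln2.
rewrite (exprD q (c + N.+2)) (exprD q c) (exprS q N.+2) (exprS q N.+1).
rewrite (exprS (- x) N.+2) (exprS (- x) N.+1).
move: (q ^+ N.+1) (q ^+ c) ((- x) ^+ N.+1) => r s X.
ring.
Qed.

(** Each use of the functional equation produces one term of the partial theta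
    series, replaces [x] by [x q^2], and raises by one the power of [x] that
    divides the error. *)
Lemma reduced_sum_theta {A : comUnitRingType} (q : A) N : forall x : A,
  (forall i, 1 - x * q ^+ i.+1 \is a GRing.unit) ->
  exists r, \sum_(m < N) reduced_term x q m =
    \sum_(n < N) (- x) ^+ n.+1 * q ^+ (n.+1 ^ 2) + x ^+ N.+1 * r.
Proof.
elim: N => [|N IHN] x xU; first by exists 0; rewrite !big_ord0 mulr0 addr0.
have [|r Er] := IHN (x * q ^+ 2).
  by move=> i; rewrite -mulrA -exprD; apply: xU.
have -> : \sum_(n < N.+1) (- x) ^+ n.+1 * q ^+ (n.+1 ^ 2) =
    - x * q * (1 + \sum_(n < N) (- (x * q ^+ 2)) ^+ n.+1 * q ^+ (n.+1 ^ 2)).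
  rewrite big_ord_recl mulrDr mulr1 mulr_sumr; congr (_ + _).
  apply: eq_bigr => n _; rewrite lift0 -mulNr exprMn -exprM [(- x) ^+ n.+2]exprS.
  have -> : (n.+2 ^ 2 = 1 + (2 * n.+1 + n.+1 ^ 2))%N by lia.
  rewrite !exprD; ring.
rewrite reduced_sum_shift // Er exprMn.
exists (- q * (q ^+ 2) ^+ N.+1 * r + (-1) ^+ N.+1 * (q ^+ 'C(N.+3, 2) *
   \prod_(i < N) (1 + q ^+ i.+1) / qpoch (x * q ^+ 2) (q ^+ 2) N.+1)).
rewrite /reduced_rest (exprNn x N.+2) (exprS (-1) N.+1) (exprS x N.+1).
move: (_^-1) (\sum_(n < N) _) => D T.
ring.
Qed.

(** * Partial double sums *)

Lemma summand2E {A : comUnitRingType} (c d q : A) m k :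
  (forall n, qpoch q q n \is a GRing.unit) ->
  c * q ^+ exponent2 m k / d * qbinom q m (2 * k%:Z) =
  c / d * row_term q m (2 * k).
Proof.
move=> qU; have -> : 2 * k%:Z = (2 * k)%N%:Z by lia.
rewrite qbinom_gauss //.
rewrite (mulrAC _ (q ^+ _)) -[LHS]mulrA; congr (_ * _).
rewrite /row_term; have [lt_m|le_m] := ltnP m (2 * k).
  by rewrite gauss_small // !mulr0.
congr (_ ^+ _ * _); rewrite /exponent2.
have E : (2 * 'C((2 * k).+1, 2) = (2 * k).+1 * (2 * k))%N.
  by rewrite -mul_bin_diag bin1.
nia.
Qed.

(** The shift to [k.+1] makes [2k - 1] a natural number; the index [k = 0] gives a
    Gaussian binomial with lower entry [-1], hence 0. *)
Lemma summand1E {A : comUnitRingType} (c d q : A) m k :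
  (forall n, qpoch q q n \is a GRing.unit) ->
  c * q ^+ exponent1 m k.+1 / d * qbinom q m (2 * k.+1%:Z - 1) =
  c / d * row_term q m (2 * k).+1.
Proof.
move=> qU; have -> : 2 * k.+1%:Z - 1 = (2 * k).+1%:Z by lia.
rewrite qbinom_gauss //.
rewrite (mulrAC _ (q ^+ _)) -[LHS]mulrA; congr (_ * _).
rewrite /row_term; have [lt_m|le_m] := ltnP m (2 * k).+1.
  by rewrite gauss_small // !mulr0.
congr (_ ^+ _ * _); rewrite /exponent1.
have E : (2 * 'C((2 * k).+2, 2) = (2 * k).+2 * (2 * k).+1)%N.
  by rewrite -mul_bin_diag bin1.
nia.
Qed.

(** Row [m = 0] vanishes here, whereas in [sum_summand2] it is the constant 1.
    Since [2k - 1 <= m] forces [k <= m] for [k > 0], bounding [k] by [N] loses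
    nothing. *)
Lemma sum_summand1 {A : comUnitRingType} (a q : A) N :
  (forall n, qpoch q q n \is a GRing.unit) ->
  \sum_(m < N.+1) \sum_(k < N.+1)
    (- a) ^+ m * q ^+ exponent1 m k / qpoch (a * q ^+ 2) (q ^+ 2) m
      * qbinom q m (2 * k%:Z - 1) =
  \sum_(m < N) reduced_term a q m.
Proof.
move=> qU.
have E m : \sum_(k < N.+1)
    (- a) ^+ m * q ^+ exponent1 m k / qpoch (a * q ^+ 2) (q ^+ 2) m
      * qbinom q m (2 * k%:Z - 1) =
    (- a) ^+ m / qpoch (a * q ^+ 2) (q ^+ 2) m
      * \sum_(k < N) row_term q m (2 * k).+1.
  rewrite big_ord_recl /= mulr0 add0r mulr_sumr.
  by apply: eq_bigr => k _; apply: summand1E.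
rewrite big_ord_recl E [X in _ * X]big1 ?mulr0 ?add0r => [|k _]; last first.
  by rewrite /row_term /= mulr0.
apply: eq_bigr => m _; rewrite E sum_row_odd //.
by rewrite /reduced_term mulrAC mulrA.
Qed.

Lemma sum_summand2 {A : comUnitRingType} (a q : A) N :
  (forall n, qpoch q q n \is a GRing.unit) ->
  \sum_(m < N.+1) \sum_(k < N.+1)
    (- a) ^+ m * q ^+ exponent2 m k / qpoch (a * q ^+ 2) (q ^+ 2) m
      * qbinom q m (2 * k%:Z) =
  1 + \sum_(m < N) reduced_term a q m.
Proof.
move=> qU.
have E m : \sum_(k < N.+1)
    (- a) ^+ m * q ^+ exponent2 m k / qpoch (a * q ^+ 2) (q ^+ 2) m
      * qbinom q m (2 * k%:Z) =
    (- a) ^+ m / qpoch (a * q ^+ 2) (q ^+ 2) m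
      * \sum_(k < N.+1) row_term q m (2 * k).
  by rewrite mulr_sumr; apply: eq_bigr => k _; apply: summand2E.
rewrite big_ord_recl E; congr (_ + _).
  have -> : \sum_(k < N.+1) row_term q 0 (2 * k) = 1.
    rewrite big_ord_recl big1 => [|k _]; first by rewrite /row_term !mulr1 addr0.
    by rewrite /row_term lift0 mulnS gauss_small ?mulr0.
  by rewrite expr0 /qpoch big_ord0 invr1 !mulr1.
apply: eq_bigr => m _; rewrite E sum_row_even //.
by rewrite /reduced_term mulrAC mulrA.
Qed.

(** * Formal power series *)

Lemma fps_unitE {R : comUnitRingType} (f : {fps R}) :
  (f \is a GRing.unit) = (fps_coef f 0 \is a GRing.unit).
Proof. by []. Qed.

Lemma fps_coef0M {R : comNzRingType} (f g : {fps R}) :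
  fps_coef (f * g) 0 = fps_coef f 0 * fps_coef g 0.
Proof. by rewrite /= big_ord1. Qed.

Lemma fps_coef_varXM {R : comNzRingType} n (f : {fps R}) i : (i < n)%N ->
  fps_coef (fps_var R ^+ n * f) i = 0.
Proof.
elim: n i => // n IHn i; rewrite exprS -mulrA => lt_in.
case: i lt_in => [|i] lt_in; first by rewrite fps_coef0M mul0r.
transitivity (fps_coef (fps_var R ^+ n * f) i); last exact: IHn.
rewrite [LHS]/= big_ord_recl mul0r add0r big_ord_recl mul1r subSS subn0.
by rewrite [X in _ + X]big1 ?addr0 // => j _; rewrite mul0r.
Qed.

Lemma coef2_sum {R : comNzRingType} {I : Type} (r : seq I)
    (F : I -> {fps {fps R}}) i j :
  coef2 (\sum_(x <- r) F x) i j = \sum_(x <- r) coef2 (F x) i j.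
Proof. exact: (big_morph (fun f => coef2 f i j)). Qed.

(** If only the terms indexed by [r i] contribute to the coefficient of [a^i], then
    that coefficient of the infinite sum is computed by a finite one. *)
Lemma fps_sum_finite {R : comUnitRingType} {I : choiceType} {D : set I}
    {F : I -> {fps {fps R}}} (r : nat -> seq I) :
  (forall i, uniq (r i)) -> (forall i, [set` r i] `<=` D)%classic ->
  (forall i x, D x -> x \notin r i -> fps_coef (F x) i = 0) ->
  fps_summable D F /\
  forall i, fps_coef (fps_sum D F) i = fps_coef (\sum_(x <- r i) F x) i.
Proof.
move=> r_uniq rD F0; split=> i.
  move=> j; apply: (sub_finite_set _ (finite_seq (r i))) => x /= [Dx nz].
  by apply: contrapT => /negP /(F0 i x Dx) F0x; apply: nz; rewrite /coef2 F0x.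
apply: fpsP => j; rewrite -[RHS]/(coef2 _ i j) coef2_sum /=.
rewrite (fsbigE (r i)) // => [|x Dx xr]; last by rewrite /coef2 F0.
rewrite big_seq_cond [RHS]big_seq; apply: eq_bigl => x.
case: (boolP (x \in r i)) => xr //=.
exact: (mem_set (rD i x xr)).
Qed.

(** * The double sums in R[[a, q]] *)

Lemma varQX_unit {R : comUnitRingType} n : 1 - varQ R ^+ n.+1 \is a GRing.unit.
Proof.
rewrite fps_unitE [fps_coef _ 0]/= exprS fps_coef0M fps_unitE /=.
by rewrite big_ord1 mul0r subr0 unitr1.
Qed.

Lemma varA_unit {R : comUnitRingType} n :
  1 - varA R * varQ R ^+ n.+1 \is a GRing.unit.
Proof.
rewrite fps_unitE [fps_coef _ 0]/= big_ord1 mul0r subr0; exact: unitr1.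
Qed.

Lemma qpochQ_unit {R : comUnitRingType} n :
  qpoch (varQ R) (varQ R) n \is a GRing.unit.
Proof. by apply: rpred_prod => i _; rewrite -exprS varQX_unit. Qed.

Lemma varA_coef_small {R : comUnitRingType} m (f : {fps {fps R}}) i : (i < m)%N ->
  fps_coef ((- varA R) ^+ m * f) i = 0.
Proof. by move=> lt_im; rewrite exprNn mulrAC mulrC fps_coef_varXM. Qed.

Lemma reduced_sum_coef {R : comUnitRingType} N :
  let a := varA R in let q := varQ R in
  fps_coef (\sum_(m < N) reduced_term a q m) N =
  fps_coef (\sum_(n < N) (- a) ^+ n.+1 * q ^+ (n.+1 ^ 2)) N.
Proof.
move=> a q; have [r ->] := reduced_sum_theta q N a varA_unit.
by rewrite -[RHS]addr0 -(fps_coef_varXM N.+1 r N (ltnSn N)).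
Qed.

Definition box (i : nat) : seq (nat * nat) :=
  [seq (m, k) | m <- index_iota 0 i.+1, k <- index_iota 0 i.+1].

Lemma box_uniq i : uniq (box i).
Proof. by apply: allpairs_uniq; rewrite ?iota_uniq // => -[? ?] [? ?]. Qed.

Lemma mem_box i m k : ((m, k) \in box i) = (m <= i)%N && (k <= i)%N.
Proof.
apply/allpairsP/andP => [[[m' k'] /= [+ + [-> ->]]]|[lm lk]].
  by rewrite !mem_index_iota !ltnS.
by exists (m, k); rewrite !mem_index_iota !ltnS.
Qed.

Lemma sum_box {V : nmodType} (F : nat -> nat -> V) i :
  \sum_(mk <- box i) (let: (m, k) := mk in F m k) =
  \sum_(m < i.+1) \sum_(k < i.+1) F m k.
Proof.
rewrite big_allpairs_dep big_mkord; apply: eq_bigr => m _.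
by rewrite big_mkord.
Qed.

Theorem theorem1p1 (R : comUnitRingType) :
  let a := varA R in
  let q := varQ R in
  let lhs1 := fun mk : nat * nat => let: (m, k) := mk in
    (- a) ^+ m * q ^+ exponent1 m k / qpoch (a * q ^+ 2) (q ^+ 2) m
      * qbinom q m (2 * k%:Z - 1) in
  let lhs2 := fun mk : nat * nat => let: (m, k) := mk in
    (- a) ^+ m * q ^+ exponent2 m k / qpoch (a * q ^+ 2) (q ^+ 2) m
      * qbinom q m (2 * k%:Z) in
  let rhs := fun n : nat => (- a) ^+ n * q ^+ (n ^ 2)%N in
  [/\ fps_summable [set: nat * nat]%classic lhs1,
      fps_summable [set n : nat | (1 <= n)%N]%classic rhs &
      fps_sum [set: nat * nat]%classic lhs1 =
      fps_sum [set n : nat | (1 <= n)%N]%classic rhs] /\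
  [/\ fps_summable [set: nat * nat]%classic lhs2,
      fps_summable [set: nat]%classic rhs &
      fps_sum [set: nat * nat]%classic lhs2 =
      fps_sum [set: nat]%classic rhs].
Proof.
move=> a q lhs1 lhs2 rhs.
have rhs0 i n : (i < n)%N -> fps_coef (rhs n) i = 0 by apply: varA_coef_small.
(* A term beyond the box is either divisible by [a^(i+1)], or has [m < k], and
   then the lower entry of its Gaussian binomial exceeds [m]. *)
have lhs_large m k (f : {fps {fps R}}) e (j : int) i :
    ~~ ((m <= i) && (k <= i))%N ->
    ((m < k)%N -> j > m%:Z) ->
    fps_coef ((- a) ^+ m * q ^+ e / f * qbinom q m j) i = 0.
  rewrite negb_and -!ltnNge => /orP[lt_im _|lt_ik lt_mj].
    by rewrite -!mulrA varA_coef_small.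
  have [lt_im|le_mi] := ltnP i m; first by rewrite -!mulrA varA_coef_small.
  rewrite /qbinom ifF ?mulr0 //; have := lt_mj (leq_ltn_trans le_mi lt_ik).
  by move=> /Order.POrderTheory.lt_geF ->; rewrite andbF.
have [s1 c1] : fps_summable setT lhs1 /\ forall i, fps_coef (fps_sum setT lhs1) i =
    fps_coef (\sum_(mk <- box i) lhs1 mk) i.
  apply: fps_sum_finite => [||i [m k] _]; [exact: box_uniq | by [] |].
  by rewrite mem_box => nmk; apply: (lhs_large m k _ _ _ _ nmk) => lt_mk; lia.
have [s2 c2] : fps_summable setT lhs2 /\ forall i, fps_coef (fps_sum setT lhs2) i =
    fps_coef (\sum_(mk <- box i) lhs2 mk) i.
  apply: fps_sum_finite => [||i [m k] _]; [exact: box_uniq | by [] |].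
  by rewrite mem_box => nmk; apply: (lhs_large m k _ _ _ _ nmk) => lt_mk; lia.
have [t1 d1] := @fps_sum_finite _ _ [set n : nat | (1 <= n)%N]%classic rhs
  (fun i => index_iota 1 i.+1) (fun=> iota_uniq _ _)
  (fun i n => ltac:(by rewrite /= mem_index_iota => /andP[]))
  (fun i n n1 => ltac:(by rewrite mem_index_iota n1 /= ltnS -ltnNge; exact: rhs0)).
have [t2 d2] := @fps_sum_finite _ _ setT rhs
  (fun i => index_iota 0 i.+1) (fun=> iota_uniq _ _) (fun i n _ => I)
  (fun i n n1 => ltac:(by rewrite mem_index_iota /= ltnS -ltnNge; exact: rhs0)).
suff [E1 E2] : fps_sum setT lhs1 = fps_sum [set n : nat | (1 <= n)%N]%classic rhs /\
    fps_sum setT lhs2 = fps_sum setT rhs.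
  exact: (conj (And3 s1 t1 E1) (And3 s2 t2 E2)).
split; apply: fpsP => i.
  rewrite c1 d1 sum_box (sum_summand1 _ _ _ qpochQ_unit) reduced_sum_coef.
  by rewrite big_add1 big_mkord.
rewrite c2 d2 sum_box (sum_summand2 _ _ _ qpochQ_unit) big_mkord.
rewrite [in RHS]big_ord_recl {1}/rhs !expr0 mulr1.
exact: (congr1 (+%R _) (reduced_sum_coef i)).
Qed.
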